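(* Let $K$ be a compact Choquet simplex, let $F\subset K$ be a closed metrizable face, and let $J=\{a\in A(K): a|_F=0\}$. Then $(A(K),J)$ has the compact quotient lifting property.
   Context: $A(K)$ denotes the Banach space of real-valued affine continuous functions on $K$ with the supremum norm. For a closed subspace $J$ of a Banach space $W$ with quotient map $\pi:W\to W/J$, the pair $(W,J)$ has the compact quotient lifting property if for every Banach space $Z$ and every compact linear operator $T:Z\to W/J$ there is a compact linear operator $S:Z\to W$ with $\pi\circ S=T$ and $\|S\|=\|T\|$. *)

(* Defs.v *)
From HB Require Import structures.
From mathcomp Require Import all_boot all_order all_algebra.
From mathcomp Require Import all_classical all_reals all_analysis.
Set Implicit Arguments. Unset Strict Implicit. Unset Printing Implicit Defensive.
Import Order.TTheory GRing.Theory Num.Theory.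
Import numFieldNormedType.Exports.
Local Open Scope classical_set_scope.
Local Open Scope ring_scope.

(* Ambient space: E : tvsType R (a locally convex topological vector space,
   assumed Hausdorff in the theorem).  Elements of A(K) are represented by
   functions E -> R; only their values on K matter. *)

Section Defs.
Variables (R : realType) (E : tvsType R).

Definition affine_cont_on (K : set E) (f : E -> R) : Prop :=
  {within K, continuous f} /\
  forall x y (t : R), K x -> K y -> 0 <= t <= 1 ->
    f (t *: x + (1 - t) *: y) = t * f x + (1 - t) * f y.

(* the supremum norm of A(K) (the [set 0] only matters when K is empty) *)
Definition AK_norm (K : set E) (f : E -> R) : \bar R :=
  ereal_sup ([set (`|f x|)%:E | x in K] `|` [set 0%E]).

Definition inJ (K F : set E) (f : E -> R) : Prop :=
  affine_cont_on K f /\ forall x, F x -> f x = 0.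

Definition quot_norm (K F : set E) (f : E -> R) : \bar R :=
  ereal_inf [set AK_norm K (f \- j) | j in inJ K F].

(* Choquet simplex: K compact convex and the cone
   C = { t (x,1) : t >= 0, x in K } in E x R is a lattice in its own order
   (u <= v iff v - u in C).  Elements of E x R are written as pairs. *)
Definition in_cone (K : set E) (u : E * R) : Prop :=
  0 <= u.2 /\ exists2 x, K x & u.1 = u.2 *: x.

Definition cone_le (K : set E) (u v : E * R) : Prop :=
  in_cone K (v.1 - u.1, v.2 - u.2).

Definition choquet_simplex (K : set E) : Prop :=
  compact K /\ convex_set K /\
  forall u v, in_cone K u -> in_cone K v ->
    exists w, [/\ in_cone K w, cone_le K u w, cone_le K v w &
      forall w', in_cone K w' -> cone_le K u w' -> cone_le K v w' ->
        cone_le K w w'].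

Definition is_face (K F : set E) : Prop :=
  F `<=` K /\ convex_set F /\
  forall x y (t : R), K x -> K y -> 0 < t < 1 -> F (t *: x + (1 - t) *: y) ->
    F x /\ F y.

Definition metrizable_subspace (F : set E) : Prop :=
  exists d : E -> E -> R,
    [/\ forall x y, F x -> F y -> (d x y = 0 <-> x = y),
        forall x y, F x -> F y -> d x y = d y x,
        forall x y z, F x -> F y -> F z -> d x z <= d x y + d y z &
        forall x (U : set E), F x ->
          (within F (nbhs x) U <->
           exists2 e : R, 0 < e & forall y, F y -> d x y < e -> U y)].

End Defs.

Section Ops.
Variables (R : realType) (E : tvsType R) (Z : normedModType R).

Definition AK_linear (K : set E) (S : Z -> E -> R) : Prop :=
  (forall z, affine_cont_on K (S z)) /\
  forall (a : R) z z' x, K x -> S (a *: z + z') x = a * S z x + S z' x.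

Definition AK_opnorm (K : set E) (S : Z -> E -> R) : \bar R :=
  ereal_sup [set AK_norm K (S z) | z in [set z : Z | `|z| <= 1]].

Definition AK_compact (K : set E) (S : Z -> E -> R) : Prop :=
  forall u : nat -> Z, (forall n, `|u n| <= 1) ->
    exists phi : nat -> nat, {homo phi : m n / (m < n)%N} /\
    exists2 g, affine_cont_on K g &
      (fun n => AK_norm K (S (u (phi n)) \- g)) @ \oo --> 0%E.

(* A map T : Z -> A(K)/J is represented by a choice of representatives
   T z in A(K); it is linear iff it is linear modulo J. *)
Definition Q_linear (K F : set E) (T : Z -> E -> R) : Prop :=
  (forall z, affine_cont_on K (T z)) /\
  forall (a : R) z z',
    inJ K F (T (a *: z + z') \- (fun x => a * T z x + T z' x)).

Definition Q_opnorm (K F : set E) (T : Z -> E -> R) : \bar R :=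
  ereal_sup [set quot_norm K F (T z) | z in [set z : Z | `|z| <= 1]].

Definition Q_compact (K F : set E) (T : Z -> E -> R) : Prop :=
  forall u : nat -> Z, (forall n, `|u n| <= 1) ->
    exists phi : nat -> nat, {homo phi : m n / (m < n)%N} /\
    exists2 g, affine_cont_on K g &
      (fun n => quot_norm K F (T (u (phi n)) \- g)) @ \oo --> 0%E.

End Ops.

Definition CQLP (R : realType) (E : tvsType R) (K F : set E) : Prop :=
  forall (Z : completeNormedModType R) (T : Z -> E -> R),
    Q_linear K F T -> Q_compact K F T ->
    exists S : Z -> E -> R,
      [/\ AK_linear K S, AK_compact K S,
          (forall z, inJ K F (S z \- T z)) &
          AK_opnorm K S = Q_opnorm K F T].

(* Main.v *)
(* The lift is S z := T z \o r for a map r : K -> F that is the identity on F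
   and turns countably many given functions a_i of A(K) into functions
   a_i \o r of A(K).  Since T is compact, the a_i can be chosen among the T z
   and uniformly dense on F in the image of the unit ball, so that T z \o r is
   in A(K) for every z; its norm is the supremum of |T z| over F, which is the
   quotient norm.

   The point r x is a cluster point of y_k in F (with y_k = x when x is in F)
   such that a_0 y_k, ..., a_{k-1} y_k are uniformly close to functions
   h_{k,0} x, ..., h_{k,k-1} x, with h_{k,i} in A(K) uniformly Cauchy in k.
   The h_{k,i} are selected, one coordinate at a time, from a relatively open
   convex subset of K x R^k; that the subset is convex is where F being a face
   is used.

   The one-coordinate selection is Edwards' separation theorem: a relatively
   open convex Psi in K x R with nonempty sections contains the graph of a
   function of A(K).  First, Psi contains the graph of a minimum of finitely
   many a in A(K): cover K by compact convex K_i with K_i x {s_i} in Psi and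
   separate points strictly above the compact convex hull of the K_i x {s_i}
   from this hull.  By symmetry there is then a maximum of finitely many b in
   A(K) with graph in Psi, strictly below that minimum.  Finally, for a simplex
   the Riesz decomposition of the cone over K shows that the convex hull of the
   graphs of the b lies strictly below that of the a, and a continuous affine
   function separates the two hulls. *)
Require Import Defs.
From HB Require Import structures.
From mathcomp Require Import all_boot all_order all_algebra.
From mathcomp Require Import all_classical all_reals all_analysis.
From mathcomp Require Import ring lra.
Import Order.TTheory GRing.Theory Num.Theory.
Import numFieldNormedType.Exports.
Set Implicit Arguments. Unset Strict Implicit. Unset Printing Implicit Defensive.
Local Open Scope classical_set_scope.
Local Open Scope ring_scope.

(** * Hahn-Banach separation *)

Section HahnBanach.
Variables (R : realType) (V : lmodType R).

(** A pair [(v, s)] in [P] encodes a constraint [f v <= s] on an unknown linear [f]. The closure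
    properties hold for the constraints of any [f]; the last clause is their consistency at [0]. *)
Definition bounding_cone (P : set (V * R)) : Prop :=
  [/\ P (0, 0),
      forall v w s t, P (v, s) -> P (w, t) -> P (v + w, s + t),
      forall (c : R) v s, 0 < c -> P (v, s) -> P (c *: v, c * s) &
      forall s, P (0, s) -> 0 <= s].

(** Zorn's lemma is applied to the sets [A] with [P]|[A] a bounding cone, rather than to the cones
    containing [P], so that the empty chain causes no trouble. *)
Lemma maximal_bounding_cone (P : set (V * R)) : bounding_cone P ->
  exists Q, [/\ bounding_cone Q, P `<=` Q &
    forall Q', bounding_cone Q' -> Q `<=` Q' -> Q' `<=` Q].
Proof.
move=> [P00 PD PZ P0].
have [|A [AG Amax]] :=
    @Zorn_bigcup (V * R)%type (fun A => bounding_cone (P `|` A)).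
  move=> F FG Ftot; split.
  - by left.
  - move=> v w s t [Pv|[A FA Av]] [Pw|[B FB Bw]].
    + by left; exact: PD.
    + have [_ BD _ _] := FG _ FB.
      by have [|] := BD _ _ _ _ (or_introl Pv) (or_intror Bw); [left|right; exists B].
    + have [_ AD _ _] := FG _ FA.
      by have [|] := AD _ _ _ _ (or_intror Av) (or_introl Pw); [left|right; exists A].
    + have [AB|BA] := Ftot _ _ FA FB.
        have [_ BD _ _] := FG _ FB.
        by have [|] := BD _ _ _ _ (or_intror (AB _ Av)) (or_intror Bw); [left|right; exists B].
      have [_ AD _ _] := FG _ FA.
      by have [|] := AD _ _ _ _ (or_intror Av) (or_intror (BA _ Bw)); [left|right; exists A].
  - move=> c v s c0 [Pv|[A FA Av]]; first by left; exact: PZ.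
    have [_ _ AZ _] := FG _ FA.
    by have [|] := AZ _ _ _ c0 (or_intror Av); [left|right; exists A].
  - move=> s [/P0//|[A FA As]].
    by have [_ _ _] := FG _ FA; apply; right.
exists (P `|` A); split; [exact: AG|by left|move=> Q' Q'G PQ' x Q'x].
have PQ : P `|` Q' = Q' by apply/setUidPr => y Py; apply: PQ'; left.
apply: contrapT => nx; apply: (Amax Q'); last by rewrite PQ.
split; first by move=> y Ay; apply: PQ'; right.
by move=> /(_ x Q'x) Ax; apply: nx; right.
Qed.

(** For a maximal cone [Q] above [P], the best bound [p v = inf {s | Q (v, s)}] is sublinear.
    Maximality gives [p w <= - p (- w)], so that [p] is odd, hence linear. *)
Lemma hahn_banach (P : set (V * R)) : bounding_cone P ->
  (forall v, exists s, P (v, s)) ->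
  exists f : {linear V -> R^o}, forall v s, P (v, s) -> f v <= s.
Proof.
move=> /maximal_bounding_cone[Q [[Q00 QD QZ Q0] PQ Qmax]] Pex.
have Qex v : exists s, Q (v, s) by have [s /PQ] := Pex v; exists s.
pose p v : R := inf [set s | Q (v, s)].
have hp v : has_inf [set s | Q (v, s)].
  split; first exact: Qex.
  have [t Qt] := Qex (- v); exists (- t) => s Qs.
  by rewrite -subr_ge0 opprK; apply: Q0; rewrite -(subrr v); exact: QD.
have ple v s : Q (v, s) -> p v <= s by move=> Qs; apply: ge_inf => //; have [] := hp v.
have pge v c : (forall s, Q (v, s) -> c <= s) -> c <= p v.
  by move=> h; apply: lb_le_inf => //; have [] := hp v.
have pD v w : p (v + w) <= p v + p w.
  rewrite -lerBlDr; apply/pge => s Qs; rewrite lerBlDr -lerBlDl.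
  by apply: pge => t Qt; rewrite lerBlDl; apply: ple; exact: QD.
have pZ (c : R) v : 0 < c -> p (c *: v) <= c * p v.
  move=> c0; rewrite -ler_pdivrMl//; apply: pge => s Qs.
  by rewrite ler_pdivrMl//; apply: ple; exact: QZ.
have pN w : p w <= - p (- w).
  (* Adjoining (w, - p (- w)) to Q keeps it a bounding cone. *)
  pose Q' := [set x : V * R | exists y c, [/\ 0 <= c, Q y &
     x = (y.1 + c *: w, y.2 + c * - p (- w))]].
  have Q'G : bounding_cone Q'.
    split.
    - by exists (0, 0), 0; rewrite /= scale0r mul0r !addr0.
    - move=> _ _ _ _ [[v s] [c [c0 Qv [-> ->]]]] [[v' s'] [c' [c'0 Qv' [-> ->]]]] /=.
      exists (v + v', s + s'), (c + c'); split; [exact: addr_ge0|exact: QD|].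
      by congr (_, _) => /=; rewrite ?scalerDl ?mulrDl addrACA.
    - move=> a _ _ a0 [[v s] [c [c0 Qv [-> ->]]]] /=.
      exists (a *: v, a * s), (a * c); split; [exact: mulr_ge0 (ltW a0) _|exact: QZ|].
      by rewrite /= scalerDr scalerA mulrDr mulrA.
    - move=> _ [[v s] [c [c0 Qv [/= /esym/eqP ve ->]]]].
      move: c0; rewrite le_eqVlt => /predU1P[c0|c0].
        by move: ve; rewrite -c0 scale0r mul0r !addr0 => /eqP v0; apply: Q0; rewrite -v0.
      rewrite mulrN subr_ge0 -ler_pdivlMl//; apply: ple.
      have -> : - w = c^-1 *: v.
        move: ve; rewrite addr_eq0 => /eqP ->.
        by rewrite scalerN scalerA mulVf ?gt_eqF// scale1r.
      by apply: QZ => //; rewrite invr_gt0.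
  have QQ' : Q `<=` Q'.
    by move=> [v s] Qv; exists (v, s), 0; rewrite scale0r mul0r !addr0.
  apply/ple/(Qmax _ Q'G QQ').
  by exists (0, 0), 1; rewrite /= scale1r mul1r !add0r.
have p0 : p 0 = 0.
  apply/eqP; rewrite eq_le ple//=; apply: pge => s; exact: Q0.
have pNE w : p (- w) = - p w.
  apply/eqP; rewrite eq_le lerNr pN /=.
  by rewrite -subr_ge0 opprK -p0 -(addNr w) pD.
have pDE v w : p (v + w) = p v + p w.
  apply/eqP; rewrite eq_le pD/=.
  by rewrite -[p v + p w]opprK lerNl -pNE opprD (le_trans (pD _ _))// !pNE opprD.
have pZE c v : p (c *: v) = c * p v.
  have pZp (a : R) u : 0 < a -> p (a *: u) = a * p u.
    move=> a0; apply/eqP; rewrite eq_le pZ//= -ler_pdivlMl//.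
    have ai0 : 0 < a^-1 by rewrite invr_gt0.
    by have := pZ _ (a *: u) ai0; rewrite scalerA mulVf ?gt_eqF// scale1r.
  have [->|c_neq0] := eqVneq c 0; first by rewrite scale0r mul0r p0.
  have [c0|c0] := ltP 0 c; first exact: pZp.
  by rewrite -[c]opprK scaleNr pNE pZp ?mulNr// oppr_gt0 lt_neqAle c_neq0.
have plin : linear (p : V -> R^o) by move=> c v w; rewrite pDE pZE.
pose f := HB.pack_for {linear V -> R^o} (p : V -> R^o)
  (GRing.isLinear.Build _ _ _ _ _ plin).
by exists f => v s /PQ; exact: ple.
Qed.
End HahnBanach.

Lemma convex_setP (R : realType) (M : lmodType R) (A : set M) :
  convex_set A <-> forall x y (t : R), A x -> A y -> 0 <= t <= 1 ->
    A (t *: x + (1 - t) *: y).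
Proof.
split => [cA x y t Ax Ay /andP[t0 t1]|cA x y l].
  by have := cA x y (Itv01 t0 t1); rewrite !inE; exact.
by rewrite !inE => Ax Ay; apply: cA => //; rewrite ge0 le1.
Qed.

Lemma convex_set_combine (R : realType) (M : lmodType R) (A : set M) x y
    (a b : R) : convex_set A -> A x -> A y -> 0 <= a -> 0 <= b ->
  exists2 z, A z & a *: x + b *: y = (a + b) *: z.
Proof.
move=> /convex_setP cA Ax Ay a0 b0.
have [ab0|ab0] := eqVneq (a + b) 0.
  have [-> ->] : a = 0 /\ b = 0 by split; lra.
  by exists x => //; rewrite addr0 !scale0r addr0.
have abgt0 : 0 < a + b by rewrite lt_neqAle eq_sym ab0 addr_ge0.
exists ((a / (a + b)) *: x + (1 - a / (a + b)) *: y).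
  apply: cA => //; rewrite divr_ge0 ?addr_ge0//=.
  by rewrite ler_pdivrMr// mul1r lerDl.
by rewrite scalerDr !scalerA; congr (_ *: _ + _ *: _); field.
Qed.

Section Tvs.
Variables (R : realType) (W : tvsType R).

Lemma tvs_cvgD (T : Type) (F : set_system T) (FF : Filter F) (f g : T -> W)
    (a b : W) :
  f @ F --> a -> g @ F --> b -> f x + g x @[x --> F] --> a + b.
Proof.
exact: (continuous2_cvg FF (h := fun x y : W => x + y)
  (@add_continuous W (a, b))).
Qed.

Lemma tvs_cvgZ (T : Type) (F : set_system T) (FF : Filter F) (k : T -> R)
    (f : T -> W) (c : R) (a : W) :
  k @ F --> c -> f @ F --> a -> k x *: f x @[x --> F] --> c *: a.
Proof.
move=> kc fa.
exact: (continuous2_cvg (V := R^o) FF (h := fun (x : R^o) (y : W) => x *: y)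
  (@scale_continuous R W (c, a))).
Qed.

Lemma nbhs_convex (x : W) (U : set W) : nbhs x U ->
  exists V, [/\ convex_set V, open V, V x & V `<=` U].
Proof.
move=> xU; have [B Bc [Bo Bb]] := @locally_convex R W.
have [V [BV Vx] VU] := Bb x U xU.
by exists V; split => //; [apply/Bc; rewrite inE|exact: Bo].
Qed.

(** A one-sided bound is enough: for [y] near [x] both [(2 / e) *: (y - x)] and its opposite lie in
    [U], whence [|f x - f y| <= e / 2]. *)
Lemma continuous_linear_bounded (f : {linear W -> R^o}) (U : set W) :
  nbhs 0 U -> (forall u, U u -> f u <= 1) -> continuous f.
Proof.
move=> U0 fU x; apply/cvgrPdist_lt => e e0.
have h (a : R) : \forall y \near x, U (a *: (y - x)).
  have : a *: (y - x) @[y --> x] --> a *: (x - x).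
    by apply: tvs_cvgZ; [exact: cvg_cst|apply: tvs_cvgD; [exact: cvg_id|exact: cvg_cst]].
  by rewrite subrr scaler0; apply.
near=> y.
have /fU : U ((2 / e) *: (y - x)) by near: y; exact: h.
have /fU : U ((- (2 / e)) *: (y - x)) by near: y; exact: h.
rewrite !linearZ linearB /= => h1 h2.
have ie : 0 < 2 / e by rewrite divr_gt0.
have : `|2 / e * (f x - f y)| <= 1.
  rewrite ler_norml; apply/andP; move: h1 h2; rewrite /GRing.scale/= => h1 h2; split; lra.
rewrite normrM gtr0_norm// -ler_pdivlMl// => /le_lt_trans; apply.
by rewrite mulr1 invf_div ltr_pdivrMr// ltr_pMr// ltr1n.
Unshelve. all: by end_near. Qed.

(** By compactness some convex neighbourhood [U] of [0] is such that [d - u] is never in [C]. The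
    constraints [f <= 1] on [U], [f >= 1] on [D] and [f <= 0] on [C] are then consistent; the first
    makes [f] continuous. *)
Lemma compact_cone_separation (D C : set W) :
  compact D -> convex_set D -> closed C -> C 0 ->
  (forall x y, C x -> C y -> C (x + y)) ->
  (forall (c : R) x, 0 < c -> C x -> C (c *: x)) ->
  D `&` C = set0 ->
  exists f : {linear W -> R^o}, [/\ continuous f, forall d, D d -> 1 <= f d &
    forall c, C c -> f c <= 0].
Proof.
move=> Dco Dcv Ccl C0 CD CZ DC.
have [[d0 Dd0]|D0] := pselect (D !=set0); last first.
  exists (\0 : {linear W -> R^o}); split => //; first exact: cst_continuous.
  by move=> d Dd; exfalso; apply: D0; exists d.
have : \forall w \near (0 : W), forall x, D x -> ~ C (x - w).
  apply: ((compact_near_coveringP D).1 Dco W (nbhs 0) (fun w x => ~ C (x - w))) => x Dx.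
  have Cx : nbhs (x - 0) (~` C).
    apply: open_nbhs_nbhs; split; first exact: closed_openC.
    by rewrite subr0 => Cx; have : (D `&` C) x by []; rewrite DC.
  exact: (@sub_continuous W (x, 0) _ Cx).
move=> /nbhs_convex[U [Ucv Uo U0 UDC]].
have nU : nbhs 0 U by exact: open_nbhs_nbhs.
(* The cone generated by the constraints [(u, 1)], [(- d, -1)] and [(c, 0)]. *)
pose P : set (W * R) := [set v | exists r u l d c,
  [/\ 0 <= r /\ 0 <= l, U u, D d, C c & v = (r *: u - l *: d + c, r - l)]].
have [||f fP] := @hahn_banach R W P.
- split.
  + exists 0, 0, 0, d0, 0; split => //.
    by rewrite !scale0r !subr0 addr0.
  + move=> _ _ _ _ [r [u [l [d [c [[r0 l0] Uu Dd Cc [-> ->]]]]]]]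
     [r' [u' [l' [d' [c' [[r'0 l'0] Uu' Dd' Cc' [-> ->]]]]]]].
    have [u2 Uu2 u2E] := convex_set_combine Ucv Uu Uu' r0 r'0.
    have [d2 Dd2 d2E] := convex_set_combine Dcv Dd Dd' l0 l'0.
    exists (r + r'), u2, (l + l'), d2, (c + c'); split => //; [|exact: CD|].
      by split; exact: addr_ge0.
    rewrite -u2E -d2E; congr (_, _); last by ring.
    by rewrite addrACA; congr (_ + _); rewrite opprD addrACA.
  + move=> a _ _ a0 [r [u [l [d [c [[r0 l0] Uu Dd Cc [-> ->]]]]]]].
    exists (a * r), u, (a * l), d, (a *: c); split => //; [|exact: CZ|].
      by split; apply: mulr_ge0 => //; exact: ltW.
    by rewrite scalerDr scalerBr !scalerA mulrBr.
  (* If [r < l], dividing [r u - l d + c = 0] by [l] puts [d - (r / l) u] in [C], although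
     [(r / l) u] is in [U] by convexity. *)
  + move=> _ [r [u [l [d [c [[r0 l0] Uu Dd Cc [/esym e ->]]]]]]].
    rewrite subr_ge0 leNgt; apply/negP => rl.
    have lgt0 : 0 < l by exact: le_lt_trans rl.
    have Ul : U ((r / l) *: u).
      have -> : (r / l) *: u = (r / l) *: u + (1 - r / l) *: 0 by rewrite scaler0 addr0.
      move/convex_setP : Ucv; apply => //; rewrite divr_ge0//=.
      by rewrite ler_pdivrMr// mul1r ltW.
    apply: (UDC _ Ul d Dd).
    have -> : d - (r / l) *: u = l^-1 *: c.
      have -> : c = l *: d - r *: u.
        by apply/eqP; rewrite -subr_eq0 opprB addrC -e addrAC.
      by rewrite scalerBr !scalerA mulVf ?gt_eqF// scale1r [_ / _]mulrC.
    by apply: CZ => //; rewrite invr_gt0.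
- move=> v; have : (k : R) *: v @[k --> (0 : R)] --> (0 : R) *: v.
    by apply: tvs_cvgZ; [exact: cvg_id|exact: cvg_cst].
  rewrite scale0r => /(_ _ nU)/nbhs_ballP[e /= e0 ev].
  exists (2 / e), (2 / e), ((e / 2) *: v), 0, d0, 0; split => //.
  - by split => //; rewrite divr_ge0// ltW.
  - apply: ev; rewrite /ball/= sub0r normrN gtr0_norm ?divr_gt0//.
    by rewrite ltr_pdivrMr// ltr_pMr// ltr1n.
  - rewrite scale0r !subr0 addr0 scalerA; congr (_, _).
    have -> : 2 / e * (e / 2) = 1 by field; rewrite gt_eqF.
    by rewrite scale1r.
exists f; split.
- apply: (continuous_linear_bounded nU) => u Uu; apply: fP.
  by exists 1, u, 0, d0, 0; rewrite scale1r scale0r !subr0 addr0.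
- move=> d Dd; rewrite -lerN2 -linearN; apply: fP.
  by exists 0, 0, 1, d, 0; rewrite scale1r scale0r !sub0r addr0; split.
- move=> c Cc; apply: fP.
  by exists 0, 0, 0, d0, c; rewrite !scale0r !subr0 add0r; split.
Qed.

End Tvs.

(** * Convex hulls of finitely many compact convex sets *)

Section Hulls.
Variables (R : realType) (W : tvsType R).

(** For nonempty convex [A] and [B] this is the convex hull of their union; it is empty as soon as
    one of them is. *)
Definition segments (A B : set W) : set W :=
  [set z.1 *: z.2.1 + (1 - z.1) *: z.2.2 | z in `[(0 : R), 1] `*` (A `*` B)].

Lemma compact_segments (A B : set W) :
  compact A -> compact B -> compact (segments A B).
Proof.
move=> Aco Bco; apply: continuous_compact; last first.
  by apply: compact_setX; [exact: segment_compact|exact: compact_setX].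
apply: continuous_subspaceT => z.
have z1 : (y : R * (W * W)).1 @[y --> z] --> z.1 by exact: cvg_fst.
have z2 : (y : R * (W * W)).2 @[y --> z] --> z.2 by exact: cvg_snd.
apply: tvs_cvgD; apply: tvs_cvgZ => //.
- by apply: (cvg_comp _ _ z2); exact: cvg_fst.
- by apply: cvgB => //; exact: cvg_cst.
- by apply: (cvg_comp _ _ z2); exact: cvg_snd.
Qed.

Lemma convex_segments (A B : set W) :
  convex_set A -> convex_set B -> convex_set (segments A B).
Proof.
move=> Acv Bcv; apply/convex_setP => _ _ t [[r [a b]] /= [r01 [Aa Bb]] <-]
  [[s [c d]] /= [s01 [Ac Bd]] <-] /andP[t0 t1].
move: r01 s01; rewrite /= !in_itv/= => /andP[r0 r1] /andP[s0 s1].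
have [x Ax xE] : exists2 x, A x &
    (t * r) *: a + ((1 - t) * s) *: c = (t * r + (1 - t) * s) *: x.
  by apply: convex_set_combine => //; apply: mulr_ge0 => //; rewrite subr_ge0.
have [y By yE] : exists2 y, B y &
    (t * (1 - r)) *: b + ((1 - t) * (1 - s)) *: d =
    (t * (1 - r) + (1 - t) * (1 - s)) *: y.
  by apply: convex_set_combine => //; apply: mulr_ge0 => //; rewrite subr_ge0.
exists (t * r + (1 - t) * s, (x, y)) => /=.
  by split => //=; rewrite in_itv/=; apply/andP; split; nra.
rewrite !scalerDr !scalerA addrACA xE yE; congr (_ + _ *: _); ring.
Qed.

Lemma segmentsl (A B : set W) : B !=set0 -> A `<=` segments A B.
Proof.
move=> [b Bb] a Aa; exists (1, (a, b)); last by rewrite /= subrr scale0r scale1r addr0.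
by split => //=; rewrite in_itv/= ler01 lexx.
Qed.

Lemma segmentsr (A B : set W) : A !=set0 -> B `<=` segments A B.
Proof.
move=> [a Aa] b Bb; exists (0, (a, b)); last by rewrite /= subr0 scale0r scale1r add0r.
by split => //=; rewrite in_itv/= ler01 lexx.
Qed.

Lemma segments_sub (A B C : set W) :
  convex_set C -> A `<=` C -> B `<=` C -> segments A B `<=` C.
Proof.
move=> /convex_setP Ccv AC BC _ [[r [a b]] /= [+ [Aa Bb]] <-].
by rewrite /= in_itv/= => r01; apply: Ccv => //; [exact: AC|exact: BC].
Qed.

(** The hull is built by iterating [segments], which keeps it compact without taking a closure.
    Empty sets are skipped, since [segments] with an empty set is empty. *)
Lemma compact_convex_hull (I : eqType) (s : seq I) (A : I -> set W) :
  (forall i, i \in s -> compact (A i) /\ convex_set (A i)) ->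
  exists D, [/\ compact D, convex_set D, forall i, i \in s -> A i `<=` D &
    forall C, convex_set C -> (forall i, i \in s -> A i `<=` C) -> D `<=` C].
Proof.
elim: s => [|i s ih] sA.
  exists set0; split; [exact: compact0|by move=> x y l /set_mem|by []|by move=> C _ _ x].
have [|D [Dco Dcv sD Dmin]] := ih.
  by move=> j js; apply: sA; rewrite inE js orbT.
have [Aico Aicv] := sA i (mem_head _ _).
have Dmin' C : convex_set C -> (forall j, j \in i :: s -> A j `<=` C) -> D `<=` C.
  by move=> Ccv sC; apply: Dmin => // j js; apply: sC; rewrite inE js orbT.
have [Ai0|Ai0] := pselect (A i !=set0); last first.
  exists D; split => // j; rewrite inE => /predU1P[->|]; last exact: sD.
  by move=> x Aix; exfalso; apply: Ai0; exists x.
have [D0|D0] := pselect (D !=set0); last first.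
  exists (A i); split => // [j|C _]; last by apply; exact: mem_head.
  rewrite inE => /predU1P[->//|js] x /(sD _ js) Dx.
  by exfalso; apply: D0; exists x.
exists (segments (A i) D); split => [|||C Ccv sC].
- exact: compact_segments.
- exact: convex_segments.
- move=> j; rewrite inE => /predU1P[->|/sD js]; first exact: segmentsl.
  by apply: subset_trans js _; exact: segmentsr.
- by apply: segments_sub => //; [exact/sC/mem_head|exact: Dmin'].
Qed.

Lemma convex_closure (A : set W) : convex_set A -> convex_set (closure A).
Proof.
move=> /convex_setP cA; apply/convex_setP => x y t Ax Ay t01 U Uz.
have zc : (p : W * W) @[p --> (x, y)] --> (x, y) by exact: cvg_id.
have : t *: p.1 + (1 - t) *: p.2 @[p --> (x, y)] --> t *: x + (1 - t) *: y.
  by apply: tvs_cvgD; apply: tvs_cvgZ; [exact: cvg_cst|exact: cvg_fst|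
    exact: cvg_cst|exact: cvg_snd].
move=> /(_ _ Uz)[[U1 U2] /= [xU1 yU2] UU].
have [a [Aa U1a]] := Ax _ xU1; have [b [Ab U2b]] := Ay _ yU2.
exists (t *: a + (1 - t) *: b); split; first exact: cA.
by apply: (UU (a, b)).
Qed.

Lemma nbhs_closed_convex (x : W) (U : set W) : nbhs x U ->
  exists V, [/\ convex_set V, closed V, nbhs x V & V `<=` U].
Proof.
move=> /uniform_regular[V xV VU].
have [C [Ccv Co Cx CV]] := nbhs_convex xV.
exists (closure C); split; [exact: convex_closure|exact: closed_closure| |].
  by apply: filterS (open_nbhs_nbhs (conj Co Cx)); exact: subset_closure.
by apply: subset_trans VU; exact: closureS.
Qed.

End Hulls.

Lemma compact_finite_index (T : topologicalType) (I : eqType) (K : set T)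
    (Q : set I) (P : I -> set T) : compact K ->
  (forall x, K x -> exists2 i, Q i & \forall y \near x, K y -> P i y) ->
  exists2 s : seq I, forall i, i \in s -> Q i &
    forall x, K x -> exists2 i, i \in s & P i x.
Proof.
move=> Kco KP.
(* Near [G] means for all lists that contain some fixed finite list; the near-covering form of
   compactness along [G] then yields a finite subcover. *)
pose G : set_system (seq I) :=
  filter_from setT (fun s : seq I => [set s' : seq I | {subset s <= s'}]).
have FG : Filter G.
  apply: filter_from_filter; first by exists [::].
  move=> s s' _ _; exists (s ++ s') => // u /= su.
  by split => i si; apply: su; rewrite mem_cat si ?orbT.
have : \forall s \near G, forall x, K x -> K x -> exists2 i, i \in s & Q i /\ P i x.
  apply: ((compact_near_coveringP K).1 Kco _ G
    (fun s x => K x -> exists2 i, i \in s & Q i /\ P i x)) => x Kx.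
  have [i Qi Pi] := KP x Kx.
  exists ([set y | K y -> P i y], [set s : seq I | {subset [:: i] <= s}]).
    by split => //; exists [:: i].
  move=> [y s] /= [Py si] Ky; exists i; last by split => //; exact: Py.
  by apply: si; rewrite mem_head.
move=> [s _ /(_ s)] h; exists [seq i <- s | `[< Q i >]].
  by move=> i; rewrite mem_filter => /andP[/asboolP].
move=> x Kx; have [//|//|//|i si [Qi Pi]] := h _ x.
by exists i => //; rewrite mem_filter si andbT; exact/asboolP.
Qed.

(** * Affine selections over simplices *)

Section Selection.
Variables (R : realType) (E : tvsType R).
Hypothesis hE : hausdorff_space E.

(** Separate [D] from the closed half-line of the [(0, t)] with [t <= 0]. The separating [f] has
    [c = f (0, 1) > 0], because [f >= 1] at a point [(0, t0)] of [D] with [t0 > 0]; solving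
    [f (x, t) >= 1] for [t] gives the bound with [e = c^-1]. *)
Lemma vertical_separation (D : set (E * R^o)) : compact D -> convex_set D ->
  (forall t, D (0, t) -> 0 < t) -> (exists t, D (0, t)) ->
  exists (g : {linear E -> R^o}) (e : R), [/\ continuous g, 0 < e &
    forall x t, D (x, t) -> g x + e <= t].
Proof.
move=> Dco Dcv Dpos [t0 Dt0].
pose C : set (E * R^o) := [set z | z.1 = 0 /\ (z.2 : R) <= 0].
have Ccl : closed C.
  have -> : C = (@fst E R^o) @^-1` [set 0] `&` (@snd E R^o) @^-1` [set t : R | t <= 0].
    by apply/seteqP; split.
  apply: closedI; apply: preimage_closed.
  - by move=> z _; exact: cvg_fst.
  - exact/accessible_closed_set1/hausdorff_accessible.
  - by move=> z _; exact: cvg_snd.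
  - exact: closed_le.
have [||||f [fc fD fC]] := compact_cone_separation Dco Dcv Ccl.
- by split.
- move=> [x s] [y t] /= [/= -> s0] [/= -> t0'].
  by split; [exact: addr0|rewrite -[leRHS]addr0; exact: lerD].
- move=> c [x s] c0 [/= -> s0].
  by split; [exact: scaler0|exact: mulr_ge0_le0 (ltW c0) s0].
- apply/seteqP; split => // -[x t] [/= Dxt [/= x0 t_le0]].
  by move: (Dpos t); rewrite -x0 => /(_ Dxt); rewrite ltNge t_le0.
pose c : R := f (0, 1).
have fE x t : f (x, t) = f (x, 0) + t * c.
  have -> : (x, t) = (x, 0) + t *: ((0, 1) : E * R^o).
    by congr (_, _) => /=; rewrite ?scaler0 ?addr0// add0r; exact/esym/mulr1.
  by rewrite linearD linearZ.
have c0 : 0 < c.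
  have := fD _ Dt0; rewrite fE [f _](_ : _ = 0) ?add0r; last first.
    by rewrite [(0, 0)](_ : _ = 0 :> E * R^o)// linear0.
  move=> h; rewrite -(pmulr_rgt0 _ (Dpos _ Dt0)); exact: lt_le_trans h.
pose g0 (x : E) : R^o := - c^-1 * f (x, 0).
have glin : linear g0.
  move=> a x y; rewrite /g0.
  have -> : (a *: x + y, 0 : R^o) = a *: (x, 0 : R^o) + (y, 0 : R^o).
    by congr (_, _) => /=; rewrite ?addr0 ?scaler0.
  by rewrite linearP /= mulrDr [in LHS]mulrCA.
pose g := HB.pack_for {linear E -> R^o} g0 (GRing.isLinear.Build _ _ _ _ _ glin).
exists g, c^-1; split.
- move=> x; apply: cvgM; first exact: cvg_cst.
  apply: (@continuous_comp _ _ _ (fun x => (x, 0 : R^o)) f); last exact: fc.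
  by apply: (@cvg_pair _ _ _ _ (nbhs x) (nbhs (0 : R^o))); [exact: cvg_id|exact: cvg_cst].
- by rewrite invr_gt0.
- move=> x t /fD; rewrite fE => h; rewrite -(ler_pM2l c0) /= /g0.
  have -> : c * (- c^-1 * f (x, 0) + c^-1) = 1 - f (x, 0) by field; rewrite gt_eqF.
  by rewrite lerBlDl mulrC.
Qed.

Definition open_over (K : set E) (Psi : E -> R -> Prop) := forall x t,
  K x -> Psi x t -> exists2 e, 0 < e & \forall y \near x, K y ->
    forall s, `|s - t| < e -> Psi y s.

Definition convex_over (K : set E) (Psi : E -> R -> Prop) :=
  forall x y s t l, K x -> K y -> Psi x s -> Psi y t -> 0 <= l <= 1 ->
    Psi (l *: x + (1 - l) *: y) (l * s + (1 - l) * t).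

Lemma convex_over_between K Psi x r s t : convex_over K Psi -> K x ->
  Psi x r -> Psi x t -> r <= s -> s <= t -> Psi x s.
Proof.
move=> Pcv Kx Pr Pt rs st.
have [rt|] := ltP r t; last by move=> tr; rewrite (_ : s = r)//; lra.
pose l := (t - s) / (t - r).
have := Pcv x x r t l Kx Kx Pr Pt; rewrite -scalerDl subrKC scale1r.
have -> : l * r + (1 - l) * t = s by rewrite /l; field; lra.
apply; rewrite /l divr_ge0 ?subr_ge0 ?(le_trans rs)//=.
by rewrite ler_pdivrMr ?subr_gt0// mul1r; lra.
Qed.

Lemma affine_cont_on_linear (K : set E) (g : {linear E -> R^o}) (c : R) :
  continuous g -> affine_cont_on K (fun x => c + g x).
Proof.
move=> gc; split.
  by apply: continuous_subspaceT => x; apply: cvgD; [exact: cvg_cst|exact: gc].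
move=> x y t _ _ _; rewrite linearD !linearZ /= /GRing.scale/=; ring.
Qed.

(** The minimum of [A] has its graph in [Psi]. That every [a] in [A] lies above a point of [Psi]
    over each [x] lets [affine_selection] find points of [Psi] strictly below all of [A]. *)
Lemma affine_envelope K Psi : compact K -> convex_set K ->
  open_over K Psi -> convex_over K Psi ->
  (forall x, K x -> exists t, Psi x t) ->
  exists2 A : seq (E -> R), forall a, a \in A -> affine_cont_on K a /\
      forall x, K x -> exists2 t, t <= a x & Psi x t &
    forall x, K x -> exists2 a, a \in A & Psi x (a x).
Proof.
move=> Kco Kcv Po Pcv Pex.
have /choice[q qP] : forall x, exists q : R * set E, K x ->
    [/\ convex_set q.2, closed q.2, nbhs x q.2 &
    forall y, K y -> q.2 y -> Psi y q.1].
  move=> x.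
  have [Kx|nKx] := pselect (K x); last by exists (0, set0).
  have [t Pt] := Pex x Kx; have [e e0 xe] := Po x t Kx Pt.
  have [V [Vcv Vcl xV VP]] := nbhs_closed_convex xe.
  by exists (t, V) => _; split => //= y Ky /VP /(_ Ky); apply; rewrite subrr normr0.
pose s x := (q x).1; pose V x := (q x).2.
have [xs xsK xsV] : exists2 xs : seq E, forall x, x \in xs -> K x &
    forall x, K x -> exists2 i, i \in xs & V i x.
  apply: compact_finite_index => // x Kx; exists x => //.
  by have [_ _ + _] := qP x Kx; apply: filterS.
(* The hull [G] of these slabs is compact and convex, lies in [Psi] and meets every vertical line
   over [K]. *)
pose P i : set (E * R^o) := (K `&` V i) `*` [set s i].
have [i ixs|G [Gco Gcv sG Gmin]] := @compact_convex_hull R (E * R^o)%type E xs P.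
  have [Vcv Vcl _ _] := qP i (xsK i ixs); split.
    by apply: compact_setX; [exact: compact_closedI|exact: compact_set1].
  apply/convex_setP => -[x a] [y b] t [[/= Kx Vx] /= ->] [[/= Ky Vy] /= ->] t01.
  split; last by rewrite /= -scalerDl subrKC scale1r.
  by move/convex_setP : Kcv => Kcv; move/convex_setP : Vcv => Vcv;
    split; [exact: Kcv|exact: Vcv].
have GP x t : G (x, t) -> K x /\ Psi x t.
  have : G `<=` [set z | K z.1 /\ Psi z.1 z.2].
    apply: Gmin => [|i ixs].
      apply/convex_setP => -[x' a] [y b] l /= [Kx Px] [Ky Py] l01.
      by split; [move/convex_setP : Kcv; exact|exact: Pcv].
    move=> [y b] [[/= Ky Vy] /= ->]; split => //.
    by have [_ _ _] := qP i (xsK i ixs); apply.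
  by move=> h /h.
have Gs x : K x -> exists t, G (x, t).
  by move=> /[dup] Kx /xsV[i ixs Vx]; exists (s i); apply: (sG i).
have Gmax x : K x -> exists2 t, G (x, t) & forall t', G (x, t') -> t' <= t.
  move=> Kx; have [t Gt] := Gs x Kx.
  have [|||[x' u] /set_mem [Gu /= xx] umax] :=
    @compact_EVT_max (E * R^o)%type R (@snd E R^o) (G `&` (@fst E R^o) @^-1` [set x]).
  - by exists (x, t).
  - apply: compact_closedI => //; apply: preimage_closed; first by move=> z _; exact: cvg_fst.
    exact/accessible_closed_set1/hausdorff_accessible.
  - by apply: continuous_subspaceT => z; exact: cvg_snd.
  subst x'; exists u => // t' Gt'; apply: (umax (x, t')); exact/mem_set.
apply: (@compact_finite_index E _ K [set a : E -> R | affine_cont_on K a /\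
  forall x, K x -> exists2 t, t <= a x & Psi x t] (fun a x => Psi x (a x))) => //.
move=> x0 Kx0.
have [t0 Gt0 t0max] := Gmax x0 Kx0.
have [_ Pt0] := GP _ _ Gt0.
have [e e0 eP] := Po x0 t0 Kx0 Pt0.
pose c := t0 + e / 2.
have Pc : Psi x0 c.
  apply: (nbhs_singleton eP) => //.
  by rewrite /c addrAC subrr add0r gtr0_norm ?divr_gt0// ltr_pdivrMr// ltr_pMr// ltr1n.
(* [c] is above the top [t0] of [G] over [x0], so [D] is positive over [0]. *)
pose D : set (E * R^o) := [set (x0, c : R^o) - z | z in G].
have [||||g [d [gc d0 gD]]] := @vertical_separation D.
- apply: continuous_compact => //; apply: continuous_subspaceT => z.
  by apply: tvs_cvgD; [exact: cvg_cst|exact: opp_continuous].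
- apply/convex_setP => _ _ t [z Gz <-] [z' Gz' <-] t01.
  exists (t *: z + (1 - t) *: z'); first by move/convex_setP : Gcv; apply.
  rewrite !scalerBr addrACA -scalerDl subrKC scale1r; congr (_ + _); exact: opprD.
- move=> t [[x u] Gxu [/eqP]]; rewrite subr_eq0 => /eqP xx0 <-.
  rewrite subr_gt0 (@le_lt_trans _ _ t0)//; last by rewrite /c ltrDl divr_gt0.
  by apply: t0max; rewrite xx0.
- by exists (c - t0), (x0, t0) => //; rewrite -[LHS]/(_, _)/= subrr.
have aG x t : G (x, t) -> t <= c - d - g x0 + g x.
  move=> Gxt; have /gD : D (x0 - x, c - t) by exists (x, t).
  rewrite linearB; set a : R := g x0; set b : R := g x => h.
  have {}h : a - b + d <= c - t := h.
  lra.
(* This function dominates [G], and at [x0] it takes the value [c - d], between [t0] and [c]; hence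
   its graph is in [Psi] near [x0]. *)
exists (fun x => c - d - g x0 + g x).
  split; first exact: affine_cont_on_linear.
  by move=> x Kx; have [t Gt] := Gs x Kx; exists t; [exact: aG|have [] := GP _ _ Gt].
have Pa : Psi x0 (c - d - g x0 + g x0).
  by apply: (convex_over_between Pcv Kx0 Pt0 Pc); [exact: aG|lra].
have [e' e'0 e'P] := Po _ _ Kx0 Pa.
have : \forall y \near x0, `|g x0 - g y| < e'.
  by move: (gc x0) => /cvgrPdist_lt; apply.
apply: filterS2 e'P => y yP ye Ky; apply: yP => //.
by rewrite distrC opprD addrACA subrr add0r.
Qed.

End Selection.

(** * Riesz decomposition, interpolation and selection over a Choquet simplex *)

Section Simplex.
Variables (R : realType) (E : tvsType R) (K : set E).
Hypothesis hE : hausdorff_space E.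
Hypothesis Ksimplex : choquet_simplex K.

Let Kco : compact K. Proof. by case: Ksimplex. Qed.
Let Kcv : convex_set K. Proof. by case: Ksimplex => _ []. Qed.

Lemma in_coneD (u v : E * R) : in_cone K u -> in_cone K v ->
  in_cone K (u.1 + v.1, u.2 + v.2).
Proof.
move=> [u0 [x Kx ux]] [v0 [y Ky vy]]; split; first exact: addr_ge0.
have [z Kz zE] := convex_set_combine Kcv Kx Ky u0 v0.
by exists z => //=; rewrite ux vy.
Qed.

Lemma cone_leE (u v : E * R) : cone_le K u v = in_cone K (v - u).
Proof. by []. Qed.

Lemma riesz_decomposition (u1 u2 v1 v2 : E * R) :
  in_cone K u1 -> in_cone K u2 -> in_cone K v1 -> in_cone K v2 ->
  u1 + u2 = v1 + v2 ->
  exists w11 w12 w21 w22, [/\ in_cone K w11 /\ in_cone K w12,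
    in_cone K w21 /\ in_cone K w22, u1 = w11 + w12 /\ u2 = w21 + w22 &
    v1 = w11 + w21 /\ v2 = w12 + w22].
Proof.
move=> u1K u2K v1K v2K uv; have [_ [_ sup]] := Ksimplex.
have [w [wK uw vw wmin]] := sup _ _ u1K v1K.
(* With [w] the supremum of [u1] and [v1], the first piece is their infimum. The first and last
   pieces are in the cone because [u1 + v1] and [u1 + u2 = v1 + v2] are upper bounds of [u1] and
   [v1]. *)
exists (u1 + v1 - w), (w - v1), (w - u1), (u1 + u2 - w); split.
- split; last exact: vw.
  apply: (wmin (u1 + v1)); first exact: in_coneD.
    by rewrite cone_leE addrC addKr.
  by rewrite cone_leE addrK.
- split; first exact: uw.
  apply: (wmin (u1 + u2)); first exact: in_coneD.
    by rewrite cone_leE addrC addKr.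
  by rewrite uv cone_leE addrC addKr.
- by split; [rewrite addrA subrK addrK|rewrite addrC addrA subrK addrAC subrr add0r].
- split; first by rewrite addrA subrK addrAC subrr add0r.
  by rewrite [RHS]addrC addrA subrK uv addrAC subrr add0r.
Qed.

(** Additivity of the extension [(r x, r) |-> r * a x] of [a] to the cone over [K], zero weights
    included. *)
Lemma affine_cont_on_combine a x y z (r s : R) : affine_cont_on K a ->
  K x -> K y -> K z -> 0 <= r -> 0 <= s ->
  (r + s) *: z = r *: x + s *: y -> (r + s) * a z = r * a x + s * a y.
Proof.
move=> [_ aaff] Kx Ky Kz r0 s0 zE.
have [rs0|rs0] := eqVneq (r + s) 0.
  have [-> ->] : r = 0 /\ s = 0 by split; lra.
  by rewrite !mul0r addr0 mul0r.
have rsgt0 : 0 < r + s by rewrite lt_neqAle eq_sym rs0 addr_ge0.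
have -> : z = (r / (r + s)) *: x + (1 - r / (r + s)) *: y.
  apply: (scalerI rs0); rewrite zE scalerDr !scalerA.
  by congr (_ *: _ + _ *: _); field.
rewrite aaff//; first by field.
by rewrite divr_ge0//= ?addr_ge0// ler_pdivrMr// mul1r lerDl.
Qed.

(** The hull [B] of the lower graphs lies strictly below the hull [A] of the upper ones, so [A - B]
    is positive over [0]. Vertical separation of this difference gives a linear [g] and a uniform
    gap [d] between [s - g y] on [B] and [t - g x] on [A]. *)
Lemma affine_interpolation22 a1 a2 b1 b2 :
  affine_cont_on K a1 -> affine_cont_on K a2 ->
  affine_cont_on K b1 -> affine_cont_on K b2 ->
  (forall x, K x -> [/\ b1 x < a1 x, b1 x < a2 x, b2 x < a1 x & b2 x < a2 x]) ->
  exists2 h, affine_cont_on K h &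
    forall x, K x -> [/\ b1 x < h x, b2 x < h x, h x < a1 x & h x < a2 x].
Proof.
move=> a1K a2K b1K b2K ba.
have [[x0 Kx0]|K0] := pselect (K !=set0); last first.
  by exists b1 => // x Kx; exfalso; apply: K0; exists x.
pose gr (f : E -> R) : set (E * R^o) := [set (x, f x : R^o) | x in K].
have grcv f : affine_cont_on K f -> convex_set (gr f).
  move=> [_ fa]; apply/convex_setP => _ _ t [x Kx <-] [y Ky <-] t01.
  exists (t *: x + (1 - t) *: y); first by move/convex_setP : Kcv; apply.
  by rewrite fa.
have grco f : affine_cont_on K f -> compact (gr f).
  move=> [fc _]; apply: continuous_compact => // x.
  apply: (@cvg_pair _ _ _ _ (nbhs (x : E)) (nbhs (f x : R^o))); last exact: fc.
  by apply: (@continuous_subspaceT _ _ K (@idfun E)) => ?; exact: cvg_id.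
have gr0 f : gr f !=set0 by exists (x0, f x0 : R^o), x0.
pose A := segments (gr a1) (gr a2); pose B := segments (gr b1) (gr b2).
pose D : set (E * R^o) := [set z.1 - z.2 | z in A `*` B].
have AB x s t : A (x, t) -> B (x, s) -> s < t.
  (* The Riesz decomposition expresses the two convex combinations equal to x
     through the same four points z11, z12, z21, z22 of K. *)
  move=> [[l [_ _]] /= [l01 [[x1 Kx1 <-] [x2 Kx2 <-]]] [/= lx lt]].
  move=> [[m [_ _]] /= [m01 [[y1 Ky1 <-] [y2 Ky2 <-]]] [/= mx ms]].
  move: l01 m01; rewrite /= !in_itv/= => /andP[l0 l1] /andP[m0 m1].
  rewrite -lt -ms /GRing.scale/=.
  have [|||||] := @riesz_decomposition (m *: y1, m) ((1 - m) *: y2, 1 - m)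
      (l *: x1, l) ((1 - l) *: x2, 1 - l).
  - by split; [exact: m0|exists y1].
  - by split; [rewrite /= subr_ge0|exists y2].
  - by split; [exact: l0|exists x1].
  - by split; [rewrite /= subr_ge0|exists x2].
  - congr (_, _) => /=; first exact: (etrans mx (esym lx)).
    by rewrite !subrKC.
  move=> [? r11] [[? r12] [[? r21] [[? r22] []]]].
  move=> [[/= r11_ge0 [z11 K11 ->]] [/= r12_ge0 [z12 K12 ->]]].
  move=> [[/= r21_ge0 [z21 K21 ->]] [/= r22_ge0 [z22 K22 ->]]].
  move=> [[y1E mE] [y2E m'E]] [[x1E lE] [x2E l'E]].
  have := affine_cont_on_combine b1K K11 K12 Ky1 r11_ge0 r12_ge0.
  rewrite -mE => /(_ y1E) ->.
  have := affine_cont_on_combine b2K K21 K22 Ky2 r21_ge0 r22_ge0.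
  rewrite -m'E => /(_ y2E) ->.
  have := affine_cont_on_combine a1K K11 K21 Kx1 r11_ge0 r21_ge0.
  rewrite -lE => /(_ x1E) ->.
  have := affine_cont_on_combine a2K K12 K22 Kx2 r12_ge0 r22_ge0.
  rewrite -l'E => /(_ x2E) ->.
  have [h11 _ _ _] := ba _ K11; have [_ h12 _ _] := ba _ K12.
  have [_ _ h21 _] := ba _ K21; have [_ _ _ h22] := ba _ K22.
  have p11 : r11 * b1 z11 <= r11 * a1 z11 by exact: ler_wpM2l (ltW h11).
  have p12 : r12 * b1 z12 <= r12 * a2 z12 by exact: ler_wpM2l (ltW h12).
  have p21 : r21 * b2 z21 <= r21 * a1 z21 by exact: ler_wpM2l (ltW h21).
  have p22 : r22 * b2 z22 <= r22 * a2 z22 by exact: ler_wpM2l (ltW h22).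
  (* If the sums were not strictly ordered, all four weights would vanish, but their sum is
     [m + (1 - m) = 1]. *)
  have strict (r u v : R) : 0 <= r -> u < v -> r * v <= r * u -> r = 0.
    by move=> r_ge0 uv ruv; nra.
  rewrite ltNge; apply/negP => hle.
  have e11 : r11 = 0 by apply: strict h11 _ => //; lra.
  have e12 : r12 = 0 by apply: strict h12 _ => //; lra.
  have e21 : r21 = 0 by apply: strict h21 _ => //; lra.
  have e22 : r22 = 0 by apply: strict h22 _ => //; lra.
  by move: m'E; rewrite mE e11 e12 e21 e22 !addr0 subr0 => /eqP; rewrite oner_eq0.
have [||||g [d [gc d0 gD]]] := @vertical_separation R E hE D.
- apply: continuous_compact; first by apply: continuous_subspaceT; exact: sub_continuous.
  by apply: compact_setX; apply: compact_segments; exact: grco.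
- have /convex_setP Acv := convex_segments (grcv _ a1K) (grcv _ a2K).
  have /convex_setP Bcv := convex_segments (grcv _ b1K) (grcv _ b2K).
  apply/convex_setP => _ _ t [[p q] /= [Ap Bq] <-] [[p' q'] /= [Ap' Bq'] <-] t01.
  exists (t *: p + (1 - t) *: p', t *: q + (1 - t) *: q').
    by split => /=; [exact: Acv|exact: Bcv].
  by rewrite /= !scalerBr opprD addrACA.
- move=> t [[[x s] [y r]] /= [Ap Bq] [/eqP + <-]].
  by rewrite subr_eq0 subr_gt0 => /eqP xy; apply: AB Bq; rewrite -xy.
- exists (a1 x0 - b1 x0), ((x0, a1 x0 : R^o), (x0, b1 x0 : R^o)) => /=.
    by split => /=; apply: segmentsl => //; exists x0.
  by congr (_, _); rewrite /= subrr.
have {}gD x s y t : A (x, t) -> B (y, s) -> s - g y + d <= t - g x.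
  move=> Axt Bys; have /gD : D (x - y, t - s) by exists ((x, t), (y, s)).
  rewrite linearB; set u : R := g x; set v : R := g y => h.
  have {}h : u - v + d <= t - s := h.
  lra.
have grA1 x : K x -> A (x, a1 x) by move=> Kx; apply: segmentsl => //; exists x.
have grA2 x : K x -> A (x, a2 x) by move=> Kx; apply: segmentsr => //; exists x.
have grB1 x : K x -> B (x, b1 x) by move=> Kx; apply: segmentsl => //; exists x.
have grB2 x : K x -> B (x, b2 x) by move=> Kx; apply: segmentsr => //; exists x.
pose S : set R := [set (z.2 : R) - g z.1 | z in B].
have Sub c : (forall y s, B (y, s) -> s - g y <= c) -> sup S <= c.
  move=> h; apply: ge_sup.
    by exists (b1 x0 - g x0), (x0, b1 x0 : R^o) => //; exact: grB1.
  by move=> _ [[y s] /= Bys <-]; exact: h.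
have Sle y s : B (y, s) -> s - g y <= sup S.
  move=> Bys; apply: ub_le_sup; last by exists (y, s).
  exists (a1 x0 - g x0) => _ [[y' s'] /= Bys' <-].
  have := gD _ _ _ _ (grA1 _ Kx0) Bys'; apply: le_trans.
  by rewrite lerDl ltW.
have leS x t : A (x, t) -> sup S + d <= t - g x.
  by move=> Axt; rewrite -lerBrDr; apply: Sub => y s Bys; rewrite lerBrDr; exact: gD.
(* Half of the gap [d] makes the inequalities strict on both sides. *)
exists (fun x => (sup S + d / 2) + g x); first exact: affine_cont_on_linear.
move=> x Kx.
move: (leS _ _ (grA1 _ Kx)) (leS _ _ (grA2 _ Kx))
  (Sle _ _ (grB1 _ Kx)) (Sle _ _ (grB2 _ Kx)).
by set u : R := g x => *; split; lra.
Qed.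

(** Induction on [A] against two lower functions, then on [B]: the interpolant obtained for the tail
    of a list stands in for that tail, which leaves two functions against two. *)
Lemma affine_interpolation (A B : seq (E -> R)) :
  (forall a, a \in A -> affine_cont_on K a) ->
  (forall b, b \in B -> affine_cont_on K b) ->
  (forall a b x, a \in A -> b \in B -> K x -> b x < a x) ->
  A != [::] -> B != [::] ->
  exists2 h, affine_cont_on K h &
    forall x, K x -> (forall a, a \in A -> h x < a x) /\
      (forall b, b \in B -> b x < h x).
Proof.
have inter2 b1 b2 (A' : seq (E -> R)) : affine_cont_on K b1 -> affine_cont_on K b2 ->
  (forall a, a \in A' -> affine_cont_on K a) ->
  (forall a x, a \in A' -> K x -> b1 x < a x /\ b2 x < a x) -> A' != [::] ->
  exists2 h, affine_cont_on K h & forall x, K x -> (forall a, a \in A' -> h x < a x) /\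
    b1 x < h x /\ b2 x < h x.
  move=> b1K b2K; elim: A' => // a A' ih AK bA _.
  have aK : affine_cont_on K a by apply: AK; rewrite mem_head.
  have ba x : K x -> b1 x < a x /\ b2 x < a x by apply: bA; rewrite mem_head.
  have [A'0|A'0] := eqVneq A' [::].
    have [x Kx|h hK bha] := affine_interpolation22 aK aK b1K b2K.
      by have [? ?] := ba x Kx.
    exists h => // x Kx; have [? ? ? _] := bha x Kx; split => // a'.
    by rewrite A'0 inE => /eqP ->.
  have [|||h hK hA'] := ih => //.
  - by move=> a' a'A; apply: AK; rewrite inE a'A orbT.
  - by move=> a' x a'A; apply: bA; rewrite inE a'A orbT.
  have [x Kx|k kK bka] := affine_interpolation22 aK hK b1K b2K.
    by have [? ?] := ba x Kx; have [_ [? ?]] := hA' x Kx.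
  exists k => // x Kx; have [? ? ? kh] := bka x Kx; split => // a'.
  rewrite inE => /predU1P[->//|a'A]; apply: (lt_trans kh).
  by have [+ _] := hA' x Kx; apply.
move=> AK; elim: B => // b B ih BK BA A0 _.
have bK : affine_cont_on K b by apply: BK; rewrite mem_head.
have ba a x : a \in A -> K x -> b x < a x by move=> aA; apply: BA => //; rewrite mem_head.
have [B0|B0] := eqVneq B [::].
  have [||h hK hP] := inter2 b b A bK bK AK => //.
    by move=> a x aA Kx; split; exact: ba.
  exists h => // x Kx; have [hA [bh _]] := hP x Kx; split => // b'.
  by rewrite B0 inE => /eqP ->.
have [||||h hK hB] := ih => //.
- by move=> b' b'B; apply: BK; rewrite inE b'B orbT.
- by move=> a b' x aA b'B; apply: BA => //; rewrite inE b'B orbT.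
have [||k kK kP] := inter2 b h A bK hK AK => //.
  by move=> a x aA Kx; split; [exact: ba|have [+ _] := hB x Kx; apply].
exists k => // x Kx; have [kA [bk hk]] := kP x Kx; split => // b'.
rewrite inE => /predU1P[->//|b'B]; apply: lt_trans hk.
by have [_] := hB x Kx; apply.
Qed.

Lemma affine_selection Psi : open_over K Psi -> convex_over K Psi ->
  (forall x, K x -> exists t, Psi x t) ->
  exists2 h, affine_cont_on K h & forall x, K x -> Psi x (h x).
Proof.
move=> Po Pcv Pex.
have [[x0 Kx0]|K0] := pselect (K !=set0); last first.
  exists (fun x => 0 + (\0 : {linear E -> R^o}) x).
    by apply: affine_cont_on_linear; exact: cst_continuous.
  by move=> x Kx; exfalso; apply: K0; exists x.
have [A AK AP] := affine_envelope hE Kco Kcv Po Pcv Pex.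
(* The reflection [t |-> - t] lets [affine_envelope] produce the lower functions too, and the second
   clause keeps them strictly below all of [A]. *)
pose Phi x t := Psi x (- t) /\ forall a, a \in A -> - t < a x.
have Aopen (B : seq (E -> R)) x t : (forall a, a \in B -> affine_cont_on K a) ->
    K x -> (forall a, a \in B -> - t < a x) ->
    exists2 e, 0 < e & \forall y \near x, K y ->
      forall s, `|s - t| < e -> forall a, a \in B -> - s < a y.
  move=> + Kx; elim: B => [_ _|b B ih BK tB].
    by exists 1 => //; apply: filterE => y ? ? ? a; rewrite in_nil.
  have [||e e0 eP] := ih.
  - by move=> a aB; apply: BK; rewrite inE aB orbT.
  - by move=> a aB; apply: tB; rewrite inE aB orbT.
  have bx : - t < b x by apply: tB; rewrite mem_head.
  have [/subspace_continuousP/(_ x Kx)/cvgrPdist_lt bc _] := BK b (mem_head _ _).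
  pose e' := (b x + t) / 2.
  have e'0 : 0 < e' by rewrite divr_gt0//; lra.
  exists (Num.min e e'); first by rewrite lt_min e0.
  move: (bc e' e'0) => be.
  apply: filterS2 eP be => y yP ye Ky s; rewrite lt_min => /andP[se se'] a.
  rewrite inE => /predU1P[->|]; last exact: yP.
  have {}ye : `|b x - b y| < e' by exact: ye.
  move: ye se'; rewrite /e' !ltr_norml => /andP[_ ye] /andP[se' _].
  clear - ye se'; lra.
have [|||B BK BP] := @affine_envelope _ _ hE K Phi Kco Kcv.
- move=> x t Kx [Pt tA].
  have [e e0 eP] := Po _ _ Kx Pt.
  have [e' e'0 e'P] := Aopen A x t (fun a aA => (AK a aA).1) Kx tA.
  exists (Num.min e e'); first by rewrite lt_min e0.
  apply: filterS2 eP e'P => y yP yP' Ky s; rewrite lt_min => /andP[se se'].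
  by split; [apply: yP => //; rewrite opprK addrC distrC|exact: yP'].
- move=> x y s t l Kx Ky [Px xA] [Py yA] l01; split.
    by have := Pcv _ _ _ _ _ Kx Ky Px Py l01; rewrite !mulrN -opprD.
  move=> a aA; have [[_ ->//] _] := AK a aA.
  rewrite opprD -!mulrN; have := xA a aA; have := yA a aA.
  move: l01 => /andP[l0 l1]; set u := - s; set v := - t => va ua.
  have [->|l_neq1] := eqVneq l 1; first by rewrite subrr !mul0r !addr0 !mul1r.
  have l_lt1 : 0 < 1 - l by rewrite subr_gt0 lt_neqAle l_neq1.
  by rewrite ler_ltD// ?ler_wpM2l ?ltr_pM2l// ltW.
- move=> x Kx.
  (* Each [a] is above a point of [Psi], which can be lowered slightly by openness; the least of
     these finitely many points is below all of [A]. *)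
  suff [t Pt tA] : exists2 t, Psi x t & forall a, a \in A -> t < a x.
    by exists (- t); rewrite /Phi opprK.
  have : forall a, a \in A -> exists2 t, t <= a x & Psi x t.
    by move=> a aA; have [_ h] := AK a aA; exact: h.
  elim: A {AK AP Phi} => [_|a A ih Ax].
    by have [t Pt] := Pex x Kx; exists t => // a; rewrite in_nil.
  have [|t Pt tA] := ih; first by move=> b bA; apply: Ax; rewrite inE bA orbT.
  have [s sa Ps] := Ax a (mem_head _ _).
  have [e e0 eP] := Po _ _ Kx Ps.
  have Ps' : Psi x (s - e / 2).
    apply: (nbhs_singleton eP) => //.
    rewrite addrAC subrr add0r normrN gtr0_norm ?divr_gt0//.
    by rewrite ltr_pdivrMr// ltr_pMr// ltr1n.
  have sa' : s - e / 2 < a x by rewrite ltrBlDr (le_lt_trans sa)// ltrDl divr_gt0.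
  exists (Num.min t (s - e / 2)); first by have [_|_] := ltP t (s - e / 2).
  move=> b; rewrite inE gt_min => /predU1P[->|/tA ->//]; by rewrite sa' orbT.
pose B' := [seq (fun x => - (b x)) | b <- B].
have nil_neq (L : seq (E -> R)) (P : (E -> R) -> Prop) :
    (exists2 a, a \in L & P a) -> L != [::].
  by case: L => // -[].
have [|||||h hK hP] := @affine_interpolation A B'.
- by move=> a /AK[].
- move=> _ /mapP[b bB ->]; have [[bc ba] _] := BK b bB; split.
    by move=> x; apply: cvgN; exact: bc.
  by move=> x y t Kx Ky t01; rewrite ba//; ring.
- move=> a _ x aA /mapP[b bB ->] Kx.
  have [_ /(_ x Kx)[t tb [_ tA]]] := BK b bB.
  by apply: le_lt_trans (tA _ aA); rewrite lerN2.
- exact: nil_neq (AP _ Kx0).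
- by have := nil_neq _ _ (BP _ Kx0); rewrite /B'; case: (B).
exists h => // x Kx; have [hA hB] := hP x Kx.
have [a aA Pa] := AP x Kx; have [b bB [Pb _]] := BP x Kx.
apply: (convex_over_between Pcv Kx Pb Pa); apply/ltW; last exact: hA.
by apply: (hB (fun x => - b x)); apply/mapP; exists b.
Qed.

(* In particular, Psi y s only depends on the first n coordinates of s. *)
Definition coord_open (n : nat) (Psi : E -> (nat -> R) -> Prop) := forall x t,
  K x -> Psi x t -> exists2 e, 0 < e & \forall y \near x, K y ->
    forall s, (forall i, (i < n)%N -> `|s i - t i| < e) -> Psi y s.

(** Coordinate [n] is selected from the projection of [Psi], again open and convex. Freezing it at
    the affine continuous [hn x] leaves a relation of the same kind in the first [n] coordinates. *)
Lemma affine_selection_coord n (Psi : E -> (nat -> R) -> Prop) :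
  coord_open n Psi ->
  (forall x y s t l, K x -> K y -> Psi x s -> Psi y t -> 0 <= l <= 1 ->
    Psi (l *: x + (1 - l) *: y) (fun i => l * s i + (1 - l) * t i)) ->
  (forall x, K x -> exists t, Psi x t) ->
  exists2 h : nat -> E -> R, forall i, affine_cont_on K (h i) &
    forall x, K x -> Psi x (h ^~ x).
Proof.
elim: n Psi => [|n ih] Psi Po Pcv Pex.
  exists (fun _ x => 0 + (\0 : {linear E -> R^o}) x).
    by move=> _; apply: affine_cont_on_linear; exact: cst_continuous.
  move=> x Kx; have [t Pt] := Pex x Kx; have [e e0 eP] := Po _ _ Kx Pt.
  exact: (nbhs_singleton eP).
have [|||hn hnK hnP] := @affine_selection (fun x r => exists2 t, t n = r & Psi x t).
- move=> x _ Kx [t <- Pt]; have [e e0 eP] := Po _ _ Kx Pt; exists e => //.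
  apply: filterS eP => y yP Ky s st.
  exists (fun i => if i == n then s else t i); first by rewrite eqxx.
  by apply: yP => // i _; case: eqP => [->//|_]; rewrite subrr normr0.
- move=> x y _ _ l Kx Ky [s <- Ps] [t <- Pt] l01.
  by exists (fun i => l * s i + (1 - l) * t i) => //; exact: Pcv.
- by move=> x Kx; have [t Pt] := Pex x Kx; exists (t n), t.
pose upd (t : nat -> R) r i := if i == n then r else t i.
have [|||h hK hP] := ih (fun x t => Psi x (upd t (hn x))).
- move=> x t Kx Pt; have [e e0 eP] := Po _ _ Kx Pt; exists e => //.
  have [/subspace_continuousP/(_ x Kx)/cvgrPdist_lt/(_ e e0) hc _] := hnK.
  apply: filterS2 eP hc => y yP yh Ky s st; apply: yP => // i.
  rewrite ltnS leq_eqVlt /upd; case: eqP => [->|_] /= ilt; last exact: st.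
  by rewrite distrC; exact: yh.
- move=> x y s t l Kx Ky Ps Pt l01.
  have := Pcv _ _ _ _ _ Kx Ky Ps Pt l01; congr (Psi _ _); apply/funext => i.
  rewrite /upd; case: eqP => // _; have [_ ->//] := hnK.
- move=> x Kx; have [t tn Pt] := hnP x Kx; exists t.
  rewrite (_ : upd t (hn x) = t)//; apply/funext => i.
  by rewrite /upd; case: eqP => [->|].
exists (fun i => if i == n then hn else h i); first by move=> i; case: eqP.
move=> x Kx; have := hP x Kx; congr (Psi _ _); apply/funext => i.
by rewrite /upd; case: eqP.
Qed.
End Simplex.

(** * Extending affine functions from a closed face *)

Lemma affine_cont_on_uniform (R : realType) (E : tvsType R) (K : set E)
    (f : E -> R) : convex_set K ->
  (forall e, 0 < e -> exists2 g, affine_cont_on K g &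
    forall x, K x -> `|f x - g x| <= e) ->
  affine_cont_on K f.
Proof.
move=> /convex_setP Kcv fK; split.
  apply/subspace_continuousP => x Kx; apply/cvgrPdist_lt => e e0.
  have [|g [/subspace_continuousP/(_ x Kx)/cvgrPdist_lt gc _] fg] := fK (e / 4).
    by rewrite divr_gt0.
  have e40 : 0 < e / 4 by rewrite divr_gt0.
  have gxy : \forall y \near x, K y -> `|g x - g y| < e / 4 := gc _ e40.
  suff : \forall y \near x, K y -> `|f x - f y| < e by [].
  apply: filterS gxy => y gxy Ky; have {}gxy := gxy Ky.
  have fgx := fg x Kx; have := fg y Ky; rewrite distrC => fgy.
  have -> : f x - f y = (f x - g x) + (g x - g y) + (g y - f y) by ring.
  apply: (le_lt_trans (ler_normD _ _)).
  apply: (le_lt_trans (lerD (ler_normD _ _) (lexx _))).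
  by clear - fgx fgy gxy e0; lra.
move=> x y t Kx Ky t01.
have Kz : K (t *: x + (1 - t) *: y) by exact: Kcv.
apply/eqP; rewrite -subr_eq0 -normr_le0; apply/ler_addgt0Pr => e e0.
rewrite add0r.
have [|g [_ ga] fg] := fK (e / 2); first by rewrite divr_gt0.
have -> : f (t *: x + (1 - t) *: y) - (t * f x + (1 - t) * f y) =
    (f (t *: x + (1 - t) *: y) - g (t *: x + (1 - t) *: y)) -
    (t * (f x - g x) + (1 - t) * (f y - g y)) by rewrite ga//; ring.
move: t01 => /andP[t0 t1].
have h1 := fg _ Kz; have h2 := fg _ Kx; have h3 := fg _ Ky.
apply: (le_trans (ler_normB _ _)).
have : `|t * (f x - g x) + (1 - t) * (f y - g y)| <= e / 2.
  apply: (le_trans (ler_normD _ _)).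
  rewrite !normrM (ger0_norm t0) [`|1 - t|]ger0_norm ?subr_ge0//.
  have -> : e / 2 = t * (e / 2) + (1 - t) * (e / 2) by ring.
  by rewrite lerD// ler_wpM2l// subr_ge0.
by clear - h1; lra.
Qed.

Lemma norm_conv_lt (R : realType) (l u v e : R) : 0 <= l <= 1 ->
  `|u| < e -> `|v| < e -> `|l * u + (1 - l) * v| < e.
Proof.
move=> /andP[l0 l1] ue ve; apply: (le_lt_trans (ler_normD _ _)).
rewrite !normrM (ger0_norm l0) [`|1 - l|]ger0_norm ?subr_ge0//.
have [->|l_neq1] := eqVneq l 1; first by rewrite subrr mul0r addr0 mul1r.
have l_lt1 : 0 < 1 - l by rewrite subr_gt0 lt_neqAle l_neq1.
have -> : e = l * e + (1 - l) * e by ring.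
by rewrite ler_ltD// ?ler_wpM2l ?ltr_pM2l// ltW.
Qed.

Lemma finite_lower_bound (R : realType) n (d : nat -> R) :
  (forall i, (i < n)%N -> 0 < d i) ->
  exists2 e, 0 < e & forall i, (i < n)%N -> e <= d i.
Proof.
elim: n => [_|n ih dn]; first by exists 1.
have [|e e0 ed] := ih; first by move=> i /ltnW; exact: dn.
exists (Num.min e (d n)); first by rewrite lt_min e0 dn.
move=> i; rewrite ltnS leq_eqVlt ge_min => /predU1P[->|/ed ->//].
by rewrite lexx orbT.
Qed.

Lemma near_forall_ltn (T : Type) (F : set_system T) (FF : Filter F) n
    (P : nat -> set T) : (forall i, (i < n)%N -> F (P i)) ->
  F [set x | forall i, (i < n)%N -> P i x].
Proof.
elim: n => [_|n ih Pn]; first by apply: filterE => x i.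
have : F [set x | forall i, (i < n)%N -> P i x].
  by apply: ih => i /ltnW; exact: Pn.
apply: filterS2 (Pn n (ltnSn n)) => x Px Px' i.
by rewrite ltnS leq_eqVlt => /predU1P[->|/Px'].
Qed.

Section Retract.
Variables (R : realType) (E : tvsType R) (K F : set E).
Hypothesis hE : hausdorff_space E.
Hypothesis Ksimplex : choquet_simplex K.
Hypothesis Fface : is_face K F.
Hypothesis Fclosed : closed F.
Hypothesis F0 : F !=set0.

Let Kco : compact K. Proof. by case: Ksimplex. Qed.
Let Kcv : convex_set K. Proof. by case: Ksimplex => _ []. Qed.
Let FK : F `<=` K. Proof. by case: Fface. Qed.
Let Fcv : convex_set F. Proof. by case: Fface => _ []. Qed.

Let Fco : compact F.
Proof. exact: subclosed_compact FK. Qed.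

Variable a : nat -> E -> R.
Hypothesis aK : forall i, affine_cont_on K (a i).

Let eps (k : nat) : R := 2^-1 ^+ k.

Let eps_gt0 k : 0 < eps k.
Proof. by rewrite exprn_gt0// invr_gt0. Qed.

Let epsS k : eps k = 2 * eps k.+1.
Proof. by rewrite /eps exprS mulrA divff// mul1r. Qed.

(** The invariant of the construction of [r], with [y] an approximation of [r x]. The functions of
    index at least [k] need only be in A(K), so [a] itself is good for [k = 0]. *)
Let good k (h : nat -> E -> R) :=
  (forall i, affine_cont_on K (h i)) /\
  forall x, K x -> exists y, [/\ F y, F x -> y = x &
    forall i, (i < k)%N -> `|h i x - a i y| < eps k].

(** The relation [Psi] collects the admissible values of [h'] at [x]. It is nonempty since the point
    [y] given for [h] provides the values [a i y]; it is open because [F] is closed, and convex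
    because [F] is a face. *)
Let step k h : good k h -> exists h', good k.+1 h' /\
  forall x i, K x -> (i < k)%N -> `|h' i x - h i x| < eps k.
Proof.
move=> [hK hF].
pose Psi x (t : nat -> R) := exists y, [/\ F y, F x -> y = x,
  forall i, (i < k.+1)%N -> `|t i - a i y| < eps k.+1 &
  forall i, (i < k)%N -> `|t i - h i x| < eps k].
have [|||h' h'K h'P] := affine_selection_coord hE Ksimplex (n := k.+1) (Psi := Psi).
- move=> x t Kx [y [Fy Fxy ty th]].
  have [|d d0 dP] := @finite_lower_bound R k.+1 (fun i => eps k.+1 - `|t i - a i y|).
    by move=> i ik; rewrite subr_gt0 ty.
  have [|d' d'0 d'P] := @finite_lower_bound R k (fun i => eps k - `|t i - h i x|).
    by move=> i ik; rewrite subr_gt0 th.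
  (* Half of the slack, since both [t] and the point it is compared with may move by [e]. *)
  pose e := Num.min d d' / 2.
  have e0 : 0 < e by rewrite divr_gt0// lt_min d0.
  have ed : e + e <= d by rewrite /e -splitr ge_min lexx.
  have ed' : e + e <= d' by rewrite /e -splitr ge_min lexx orbT.
  exists e => //.
  have nearcont (f : E -> R) : affine_cont_on K f ->
      \forall z \near x, K z -> `|f z - f x| < e.
    move=> [/subspace_continuousP/(_ x Kx)/cvgrPdist_lt/(_ e e0) fc _].
    have {}fc : \forall z \near x, K z -> `|f x - f z| < e := fc.
    by apply: filterS fc => z fxz Kz; rewrite distrC; exact: fxz.
  (* If [x] is not in [F], neither are the points near it, and [y] can be kept. Otherwise [y = x],
     and [y'] is [z] or [x] according to whether [z] is in [F]. *)
  have near1 : \forall z \near x, K z -> exists y', [/\ F y', F z -> y' = z &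
      forall i, (i < k.+1)%N -> `|a i y' - a i y| < e].
    have [Fx|nFx] := pselect (F x); last first.
      have : nbhs x (~` F) by apply: open_nbhs_nbhs; split => //; exact: closed_openC.
      apply: filterS => z nFz Kz; exists y; split => // i ik.
      by rewrite subrr normr0.
    have near0 : \forall z \near x, forall i, (i < k.+1)%N -> K z -> `|a i z - a i x| < e.
      by apply: near_forall_ltn => i _; exact: nearcont.
    apply: filterS near0 => z az Kz; rewrite (Fxy Fx).
    have [Fz|nFz] := pselect (F z).
      by exists z; split => // i ik; exact: az.
    by exists x; split => // i ik; rewrite subrr normr0.
  have near2 : \forall z \near x, forall i, (i < k)%N -> K z -> `|h i z - h i x| < e.
    by apply: near_forall_ltn => i _; exact: nearcont.
  apply: filterS2 near1 near2 => z z1 z2 Kz s st.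
  have [y' [Fy' Fzy' ay']] := z1 Kz; exists y'; split => // i ik.
  + have := dP i ik; have := st i ik; have := ay' i ik => h1 h2 h3.
    have -> : s i - a i y' = (s i - t i) + (t i - a i y) - (a i y' - a i y) by ring.
    apply: (le_lt_trans (ler_normB _ _)).
    apply: (le_lt_trans (lerD (ler_normD _ _) (lexx _))).
    by lra.
  + have := d'P i ik; have := st i (ltnW ik); have := z2 i ik Kz => h1 h2 h3.
    have -> : s i - h i z = (s i - t i) + (t i - h i x) - (h i z - h i x) by ring.
    apply: (le_lt_trans (ler_normB _ _)).
    apply: (le_lt_trans (lerD (ler_normD _ _) (lexx _))).
    by lra.
- move=> x x' s t l Kx Kx' [y [Fy Fxy sy sh]] [y' [Fy' Fxy' ty' th']] l01.
  exists (l *: y + (1 - l) *: y'); split.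
  + by move/convex_setP : Fcv; apply.
  + move=> Flx.
    have [l0|l0] := eqVneq l 0.
      move: Flx; rewrite l0 !scale0r !add0r subr0 !scale1r; exact: Fxy'.
    have [l1|l1] := eqVneq l 1.
      move: Flx; rewrite l1 subrr !scale0r !addr0 !scale1r; exact: Fxy.
    (* An interior point of the segment lies in [F], so both ends do; then [y = x] and [y' = x']. *)
    have [_ [_ /(_ x x' l Kx Kx')]] := Fface.
    move: l01 => /andP[l_ge0 l_le1]; rewrite lt_neqAle eq_sym l0 l_ge0 lt_neqAle l1 l_le1.
    by move=> /(_ isT Flx)[/Fxy -> /Fxy' ->].
  + move=> i ik; have [_ ->//] := aK i; [|exact: FK|exact: FK].
    rewrite (_ : _ - _ = l * (s i - a i y) + (1 - l) * (t i - a i y')); last by ring.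
    by apply: norm_conv_lt => //; [exact: sy|exact: ty'].
  + move=> i ik; have [_ ->//] := hK i.
    rewrite (_ : _ - _ = l * (s i - h i x) + (1 - l) * (t i - h i x')); last by ring.
    by apply: norm_conv_lt => //; [exact: sh|exact: th'].
- move=> x Kx; have [y [Fy Fxy hy]] := hF x Kx.
  exists (fun i => a i y), y; split => // i ik; first by rewrite subrr normr0.
  by rewrite distrC; exact: hy.
exists h'; split; last by move=> x i Kx ik; have [y [_ _ _]] := h'P x Kx; apply.
by split => // x Kx; have [y [Fy Fxy hy _]] := h'P x Kx; exists y.
Qed.

Lemma face_retraction : exists r : E -> E,
  [/\ forall x, K x -> F (r x), forall x, F x -> r x = x &
      forall i, affine_cont_on K (a i \o r)].
Proof.
have [y0 Fy0] := F0.
have /choice[nxt nxtP] : forall kh : nat * (nat -> E -> R), exists h',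
    good kh.1 kh.2 -> good kh.1.+1 h' /\
    forall x i, K x -> (i < kh.1)%N -> `|h' i x - kh.2 i x| < eps kh.1.
  move=> [k h]; have [/step[h' h'P]|nh] := pselect (good k h); first by exists h'.
  by exists h.
pose H k := nat_rect (fun _ => nat -> E -> R) a (fun k h => nxt (k, h)) k.
have Hgood k : good k (H k).
  elim: k => [|k ih]; last by have [] := nxtP (k, H k) ih.
  split => // x Kx; have [Fx|nFx] := pselect (F x); first by exists x.
  by exists y0.
have HS k x i : K x -> (i < k)%N -> `|H k.+1 i x - H k i x| < eps k.
  by have [_] := nxtP (k, H k) (Hgood k); apply.
(* The right-hand side is the geometric sum [eps k + ... + eps (k + m - 1)]. *)
have HD k m x i : K x -> (i < k)%N ->
    `|H (k + m)%N i x - H k i x| <= 2 * eps k - 2 * eps (k + m)%N.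
  move=> Kx ik; elim: m => [|m ih]; first by rewrite addn0 !subrr normr0.
  rewrite addnS (_ : _ - _ = (H (k + m).+1 i x - H (k + m)%N i x) +
    (H (k + m)%N i x - H k i x)); last by ring.
  apply: (le_trans (ler_normD _ _)).
  have /ltW h := HS (k + m)%N x i Kx (ltn_addr _ ik).
  have := epsS (k + m); lra.
have /choice[r rP] : forall x, exists y, K x -> [/\ F y, F x -> y = x &
    forall i k, (i < k)%N -> `|H k i x - a i y| <= 4 * eps k].
  move=> x; have [Kx|nKx] := pselect (K x); last by exists x.
  have /choice[u uP] : forall k, exists y, [/\ F y, F x -> y = x &
      forall i, (i < k)%N -> `|H k i x - a i y| < eps k].
    by move=> k; have [_ /(_ x Kx)] := Hgood k.
  have [Fx|nFx] := pselect (F x).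
    exists x => _; split => // i k ik; have [_ /(_ Fx) uk /(_ i ik)] := uP k.
    by rewrite uk => h; have := eps_gt0 k; lra.
  (* Through some [u m] close to [y] with [m >= k], the error splits into at most [eps m],
     [2 * eps k - 2 * eps m] and [eps k], which is less than [4 * eps k]. *)
  have [|y [Fy yu]] := @Fco (u @ \oo) _.
    by exists 0%N => // k _ /=; have [] := uP k.
  exists y => _; split => // i k ik.
  have [/subspace_continuousP/(_ y (FK Fy))/cvgrPdist_lt/(_ _ (eps_gt0 k)) ac _] := aK i.
  have ku : (u @ \oo) [set u m | m in [set m | (k <= m)%N]].
    by exists k => // m /= km; exists m.
  have [_ [[m /= km <-] aum]] := yu _ _ ku ac.
  have [Fum _ /(_ i (leq_trans ik km)) hm] := uP m.
  have {}aum : `|a i y - a i (u m)| < eps k by apply: aum; exact: FK.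
  have := HD k (m - k)%N x i Kx ik; rewrite subnKC// => hkm.
  have -> : H k i x - a i y = (H m i x - a i (u m)) - (H m i x - H k i x) -
      (a i y - a i (u m)) by ring.
  apply: (le_trans (ler_normB _ _)); apply: (le_trans (lerD (ler_normB _ _) (lexx _))).
  have ek := eps_gt0 k; have em := eps_gt0 m; lra.
exists r; split => [x Kx|x Fx|i]; first by have [] := rP x Kx.
  by have [_ + _] := rP x (FK Fx); apply.
apply: affine_cont_on_uniform => // e e0.
have : eps k @[k --> \oo] --> (0 : R).
  by apply: cvg_expr; rewrite gtr0_norm ?invr_gt0// invf_lt1// ltr1n.
move=> /cvgrPdist_lt/(_ (e / 4)); rewrite divr_gt0// => /(_ isT)[k _ ke].
(* Coordinate [i] is controlled only from stage [i.+1] on. *)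
exists (H (maxn k i.+1) i); first by have [+ _] := Hgood (maxn k i.+1); apply.
move=> x Kx; have [_ _ /(_ i (maxn k i.+1))] := rP x Kx.
rewrite leq_max leqnn orbT distrC => /(_ isT) /le_trans; apply.
have := ke (maxn k i.+1); rewrite /= leq_maxl => /(_ isT).
by rewrite sub0r normrN gtr0_norm// => h; lra.
Qed.

End Retract.

(** * Lifting compact operators *)

Section Norms.
Variables (R : realType) (E : tvsType R) (K F : set E).

Lemma affine_cont_onB (f g : E -> R) :
  affine_cont_on K f -> affine_cont_on K g -> affine_cont_on K (f \- g).
Proof.
move=> [fc fa] [gc ga]; split; first by move=> x; apply: cvgB; [exact: fc|exact: gc].
by move=> x y t Kx Ky t01; rewrite /= fa// ga//; ring.
Qed.

Lemma affine_cont_onZ (c : R) (f : E -> R) :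
  affine_cont_on K f -> affine_cont_on K (fun x => c * f x).
Proof.
move=> [fc fa]; split; first by move=> x; apply: cvgM; [exact: cvg_cst|exact: fc].
by move=> x y t Kx Ky t01; rewrite fa//; ring.
Qed.

Lemma AK_norm_ge (f : E -> R) x : K x -> ((`|f x|)%R%:E <= AK_norm K f)%E.
Proof. by move=> Kx; apply: ereal_sup_ubound; left; exists x. Qed.

Lemma AK_norm_ge0 (f : E -> R) : (0 <= AK_norm K f)%E.
Proof. by apply: ereal_sup_ubound; right. Qed.

Lemma AK_norm_le (f : E -> R) (c : \bar R) : (0 <= c)%E ->
  (forall x, K x -> ((`|f x|)%R%:E <= c)%E) -> (AK_norm K f <= c)%E.
Proof. by move=> c0 fc; apply: ge_ereal_sup => _ [[x Kx <-]|->//]; exact: fc. Qed.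

Lemma quot_norm_ge0 (f : E -> R) : (0 <= quot_norm K F f)%E.
Proof. by apply: le_ereal_inf_tmp => _ [j _ <-]; exact: AK_norm_ge0. Qed.

Lemma quot_norm_ge (f : E -> R) y : F `<=` K -> F y ->
  ((`|f y|)%R%:E <= quot_norm K F f)%E.
Proof.
move=> FK Fy; apply: le_ereal_inf_tmp => _ [j [_ j0] <-].
by rewrite (le_trans _ (AK_norm_ge _ (FK _ Fy)))//= j0// subr0.
Qed.

Lemma quot_norm_le (f j : E -> R) : inJ K F j ->
  (quot_norm K F f <= AK_norm K (f \- j)%R)%E.
Proof. by move=> Jj; apply: ereal_inf_lbound; exists j. Qed.

(** Representatives of a class agree on [F], where [f \o r] takes all its values from [f]; this
    bounds its norm by the quotient norm. Conversely [f \o r] represents the class of [f]. *)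
Lemma AK_norm_retraction (r : E -> E) (f : E -> R) : F `<=` K ->
  (forall x, K x -> F (r x)) -> (forall x, F x -> r x = x) ->
  affine_cont_on K f -> affine_cont_on K (f \o r) ->
  AK_norm K (f \o r) = quot_norm K F f.
Proof.
move=> FK rF rid fK frK; apply/eqP; rewrite eq_le; apply/andP; split.
  apply: AK_norm_le; first exact: quot_norm_ge0.
  by move=> x Kx; apply: quot_norm_ge => //; exact: rF.
have -> : f \o r = f \- (f \- (f \o r)) by apply/funext => x /=; ring.
apply: quot_norm_le; split; first exact: affine_cont_onB.
by move=> x Fx /=; rewrite rid// subrr.
Qed.

Lemma quot_norm_cvg0 (f : nat -> E -> R) e : F `<=` K -> 0 < e ->
  (fun n => quot_norm K F (f n)) @ \oo --> 0%E ->
  \forall n \near \oo, forall y, F y -> `|f n y| < e.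
Proof.
move=> FK e0 f0.
have : nbhs (0%E : \bar R) [set x | (x < e%:E)%E].
  by apply: open_nbhs_nbhs; split; [exact: open_ereal_lt_ereal|rewrite /= lte_fin].
move=> /f0 fe; near=> n => y Fy.
have fen : (quot_norm K F (f n) < e%:E)%E by near: n; exact: fe.
by rewrite -lte_fin; exact: le_lt_trans (quot_norm_ge (f n) FK Fy) fen.
Unshelve. all: by end_near. Qed.

End Norms.

Section Lifting.
Variables (R : realType) (E : tvsType R) (K F : set E) (Z : normedModType R).
Hypothesis FK : F `<=` K.
Variable T : Z -> E -> R.
Hypothesis Tlin : Q_linear K F T.
Hypothesis Tco : Q_compact K F T.

(** Otherwise a greedy choice gives a sequence in the unit ball whose images are pairwise more than
    [e] apart on [F], so that no subsequence converges in the quotient. *)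
Lemma compact_range_net (e : R) : 0 < e -> exists L : seq Z,
  forall z, `|z| <= 1 -> exists2 w, w \in L & forall y, F y -> `|T z y - T w y| <= e.
Proof.
move=> e0; apply: contrapT => noL.
have /choice[nxt nxtP] : forall L : seq Z, exists z, `|z| <= 1 /\
    forall w, w \in L -> exists2 y, F y & e < `|T z y - T w y|.
  move=> L; apply: contrapT => noz; apply: noL; exists L => z z1.
  apply: contrapT => now; apply: noz; exists z; split => // w wL.
  apply: contrapT => noy; apply: now; exists w => // y Fy.
  by rewrite leNgt; apply/negP => ey; apply: noy; exists y.
pose L n := iter n (fun L => nxt L :: L) [::].
pose u n := nxt (L n).
have uL m n : (m < n)%N -> u m \in L n.
  elim: n => // n ih; rewrite ltnS leq_eqVlt inE => /predU1P[->|/ih ->]; first by rewrite eqxx.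
  by rewrite orbT.
have [|phi [phi_lt [g gK gT]]] := Tco (u := u); first by move=> n; have [] := nxtP (L n).
have [|N _ NP] := quot_norm_cvg0 FK _ gT (e := e / 2); first by rewrite divr_gt0.
have [_ /(_ _ (uL _ _ (phi_lt _ _ (ltnSn N))))[y Fy]] := nxtP (L (phi N.+1)).
have := NP N.+1 (leqnSn N) y Fy; have := NP N (leqnn N) y Fy.
rewrite -/(u _) /= => h1 h2; apply/negP; rewrite -leNgt.
have -> : T (u (phi N.+1)) y - T (u (phi N)) y =
  (T (u (phi N.+1)) y - g y) - (T (u (phi N)) y - g y) by ring.
apply: (le_trans (ler_normB _ _)); lra.
Qed.

Lemma compact_range_dense : exists zs : nat -> Z, forall z e, `|z| <= 1 -> 0 < e ->
  exists i, forall y, F y -> `|T z y - T (zs i) y| <= e.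
Proof.
have /choice[L LP] : forall k : nat, exists L : seq Z, forall z, `|z| <= 1 ->
    exists2 w, w \in L & forall y, F y -> `|T z y - T w y| <= k.+1%:R^-1.
  by move=> k; apply: compact_range_net; rewrite invr_gt0.
(* Enumerates the nets of all radii [1 / (k + 1)] by coding pairs (net, position); the default
   values only add harmless terms. *)
pose zs i := let kj := odflt (0%N, 0%N) (unpickle i) in nth 0 (L kj.1) kj.2.
exists zs => z e z1 e0.
have [k ke] : exists k : nat, (k.+1%:R^-1 : R) <= e.
  exists (Num.truncn e^-1).
  rewrite invf_ple ?posrE ?ltr0n//; apply/ltW.
  by apply: truncnS_gt.
have [w wL Tw] := LP k z z1.
exists (pickle (k, index w (L k))) => y Fy.
by rewrite /zs pickleK /= nth_index// (le_trans (Tw y Fy)).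
Qed.

Lemma Q_linear_scale (c : R) z y : F y -> T (c *: z) y = c * T z y.
Proof.
have [_ TL] := Tlin; move=> Fy.
have T0 : T 0 y = 0.
  by have [_ /(_ y Fy) /=] := TL 1 0 0; rewrite scaler0 addr0 mul1r => h; lra.
have [_ /(_ y Fy) /=] := TL c z 0; rewrite addr0 T0 addr0 => /eqP.
by rewrite subr_eq0 => /eqP.
Qed.

End Lifting.

Theorem theorem7 (R : realType) (E : tvsType R) (K F : set E) :
  hausdorff_space E ->
  choquet_simplex K ->
  is_face K F -> closed F -> metrizable_subspace F ->
  CQLP K F.
Proof.
move=> hE Ks Ff Fcl _ Z T Tlin Tco.
have [TK TL] := Tlin; have [_ [Kcv _]] := Ks; have [FK _] := Ff.
(* If [F] is empty, J is all of A(K), the quotient norm vanishes and [0] is a lift. *)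
have [F0|F0] := pselect (F !=set0); last first.
  have zeroK : affine_cont_on K (fun=> 0 : R).
    by split; [exact: cst_continuous|move=> *; rewrite !mulr0 addr0].
  have norm0 : AK_norm K (fun=> 0 : R) = 0%E.
    apply/eqP; rewrite eq_le AK_norm_ge0 andbT; apply: AK_norm_le => // x _.
    by rewrite normr0.
  have sub0 : (fun=> 0 : R) \- (fun=> 0 : R) = (fun=> 0) :> (E -> R).
    by apply/funext => x /=; rewrite subr0.
  exists (fun _ _ => 0); split.
  - by split => // *; rewrite mulr0 addr0.
  - move=> u _; exists id; split => //; exists (fun=> 0) => //.
    by rewrite sub0 norm0; exact: cvg_cst.
  - by move=> z; split => [|y Fy]; [exact: affine_cont_onB|exfalso; apply: F0; exists y].
  - congr (ereal_sup _); apply: eq_imagel => z _; rewrite norm0.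
    apply/eqP; rewrite eq_le quot_norm_ge0 /= -norm0.
    rewrite [X in AK_norm K X](_ : _ = T z \- T z); last by apply/funext => x /=; rewrite subrr.
    by apply: quot_norm_le; split => // y Fy; exfalso; apply: F0; exists y.
have [zs zsP] := compact_range_dense FK Tco.
have [r [rF rid rK]] := face_retraction hE Ks Ff Fcl F0 (fun i => TK (zs i)).
have SK z : affine_cont_on K (T z \o r).
  apply: affine_cont_on_uniform => // e e0.
  (* Density is known on the unit ball only: [z / c] is approximated within [e / c], and the result
     is scaled back by [c]. *)
  pose c := `|z| + 1.
  have c0 : 0 < c by rewrite ltr_wpDl.
  have [||i iP] := zsP (c^-1 *: z) (e / c).
  - by rewrite normrZ gtr0_norm ?invr_gt0// ler_pdivrMl// mulr1 lerDl.
  - by rewrite divr_gt0.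
  exists (fun x => c * (T (zs i) \o r) x); first exact: affine_cont_onZ.
  move=> x Kx /=; have Fr := rF x Kx.
  have := iP _ Fr; rewrite (Q_linear_scale Tlin)// => h.
  rewrite -[T z (r x)](mulVKf (lt0r_neq0 c0)) -mulrBr normrM gtr0_norm//.
  by rewrite mulrC -ler_pdivlMr.
exists (fun z => T z \o r); split.
- split => // a z z' x Kx /=.
  by have [_ /(_ _ (rF x Kx)) /= /eqP] := TL a z z'; rewrite subr_eq0 => /eqP.
- move=> u u1; have [phi [phi_lt [g gK gT]]] := Tco u u1.
  (* [g] need not be among the [T z], but on [F] it is a uniform limit of some of them, so [g \o r]
     is a uniform limit of functions of A(K). *)
  have grK : affine_cont_on K (g \o r).
    apply: affine_cont_on_uniform => // e e0.
    have [N _ NP] := quot_norm_cvg0 FK e0 gT.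
    exists (T (u (phi N)) \o r) => // x Kx /=.
    by rewrite distrC; apply/ltW; exact: (NP N (leqnn N) _ (rF x Kx)).
  exists phi; split => //; exists (g \o r) => //.
  (* Composition with [r] turns quotient norms into norms of A(K), so convergence in the quotient
     carries over to the lifts. *)
  rewrite (_ : (fun n => _) = fun n => quot_norm K F (T (u (phi n)) \- g))//.
  apply/funext => n; rewrite -(@AK_norm_retraction _ _ K F r)//.
    exact: affine_cont_onB.
  exact: (affine_cont_onB (SK _) grK).
- move=> z; split; first exact: affine_cont_onB.
  by move=> x Fx /=; rewrite rid// subrr.
- congr (ereal_sup _); apply: eq_imagel => z _.
  exact: AK_norm_retraction.
Qed.
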